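(* Let $K$ be a field, $x=(x_1,\dots,x_n)$ an $n$-tuple of variables, and let $L$ be a field with $K\subseteq L \subseteq K(x)$. Then $L$ is finitely generated over $K$ as a field. If $L = K(\phi_1,\phi_2,\ldots,\phi_s)$, then $$\operatorname{rk} \mathcal{J}(\phi_1,\phi_2,\ldots,\phi_s) \le \operatorname{trdeg}_K (L),$$ and equality holds if and only if $K(x)$ is separable over $L$.
   Context: $K(x)$ is the field of rational functions in $x_1,\dots,x_n$ over $K$. $\mathcal{J}(\phi_1,\dots,\phi_s)$ is the $s\times n$ Jacobian matrix $(\partial\phi_i/\partial x_j)_{i,j}$ over $K(x)$, and $\operatorname{rk}$ is its rank over $K(x)$. The extension $K(x)/L$ need not be algebraic; separable means separably generated, i.e. there is a transcendence basis $B$ of $K(x)$ over $L$ such that $K(x)$ is a separable algebraic extension of $L(B)$. *)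

(* Defs.v *)
From mathcomp Require Import all_boot all_algebra all_field.
From mathcomp Require Import mpoly ring.
From Stdlib Require ClassicalEpsilon.

Set Implicit Arguments.
Unset Strict Implicit.
Unset Printing Implicit Defensive.

Import GRing.Theory.
Local Open Scope ring_scope.
Local Open Scope quotient_scope.

(* Subsets of the ambient field F are Prop-valued predicates: membership in an
   intermediate field need not be decidable, and F need not be of finite
   dimension over the base field, so {subfield F} is not applicable. *)
Section Extensions.
Variable F : fieldType.
Implicit Types (k E S B : F -> Prop) (a : F).

Definition is_subfield E : Prop :=
  [/\ E 1, forall x y, E x -> E y -> E (x - y)
         & forall x y, E x -> E y -> E (x / y)].

Definition adjoin k S : F -> Prop := fun a =>
  forall E, is_subfield E -> (forall x, k x -> E x) ->
            (forall x, S x -> E x) -> E a.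

Definition poly_over k (p : {poly F}) : Prop := forall i, k p`_i.

Definition mpoly_over k m (p : {mpoly F[m]}) : Prop := forall u, k p@_u.

Definition algebraic_over k a : Prop :=
  exists p : {poly F}, [/\ poly_over k p, p != 0 & root p a].

Definition is_min_poly k a (p : {poly F}) : Prop :=
  [/\ poly_over k p, p \is monic, root p a
    & forall q, poly_over k q -> q != 0 -> root q a -> (size p <= size q)%N].

Definition separable_over k a : Prop :=
  exists p, is_min_poly k a p /\ separable_poly p.

Definition alg_independent k B : Prop :=
  forall m (b : 'I_m -> F), injective b -> (forall i, B (b i)) ->
  forall p : {mpoly F[m]}, mpoly_over k p -> p.@[b] = 0 -> p = 0.

Definition transcendence_basis k E B : Prop :=
  [/\ forall a, B a -> E a, alg_independent k B
    & forall a, E a -> algebraic_over (adjoin k B) a].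

Definition has_trdeg k E d : Prop :=
  exists s : seq F,
    [/\ uniq s, size s = d & transcendence_basis k E (fun a => a \in s)].

(* Meaningful only when E/k has a finite transcendence basis, as is the case
   for every E inside a finitely generated extension of k. *)
Definition trdeg k E : nat :=
  ClassicalEpsilon.epsilon (inhabits 0%N) (has_trdeg k E).

Definition separably_generated k E : Prop :=
  exists B, transcendence_basis k E B
         /\ forall a, E a -> separable_over (adjoin k B) a.

End Extensions.

Lemma frac_repr (R : idomainType) (f : {fraction R}) :
  f = tofrac (frac (repr f)).1 / tofrac (frac (repr f)).2.
Proof.
have d0 := denom_ratioP (repr f).
apply: (mulIf (_ : tofrac (frac (repr f)).2 != 0)); first by rewrite tofrac_eq0.
rewrite mulfVK ?tofrac_eq0 // -{1}[f]reprK; unlock FracField.tofrac.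
rewrite -[LHS]FracField.pi_mul /FracField.mulf /= !numden_Ratio ?oner_eq0 //.
apply/eqmodP; rewrite /= FracField.equivfE.
by rewrite !numden_Ratio ?(oner_eq0, mulr1) // mulrC.
Qed.

Notation ratfun n K := {fraction {mpoly K[n]}}.

Section RationalFunctions.
Variables (K : fieldType) (n : nat).

Definition ratfun_const : ratfun n K -> Prop :=
  fun f => exists c : K, f = tofrac c%:MP.

Definition generated_by s (phi : 'I_s -> ratfun n K) : ratfun n K -> Prop :=
  adjoin ratfun_const (fun f => exists i, f = phi i).

(* The quotient rule applied to the representative of f chosen by the quotient
   structure; ratderivE shows that any other fraction gives the same value. *)
Definition ratderiv (j : 'I_n) (f : ratfun n K) : ratfun n K :=
  let p := (frac (repr f)).1 in
  let q := (frac (repr f)).2 in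
  tofrac (mderiv j p * q - p * mderiv j q) / tofrac q ^+ 2.

Lemma ratderivE (j : 'I_n) (p q : {mpoly K[n]}) : q != 0 ->
  ratderiv j (tofrac p / tofrac q) =
  tofrac (mderiv j p * q - p * mderiv j q) / tofrac q ^+ 2.
Proof.
move=> q0; rewrite /ratderiv; set f := tofrac p / tofrac q.
have := frac_repr f; have := denom_ratioP (repr f).
case: (repr f) => -[a b] b0 /= _ fE; rewrite /= in b0.
have eab : a * q = p * b.
  move/eqP: fE; rewrite eqr_div ?tofrac_eq0 // -!tofracM tofrac_eq.
  by move/eqP.
have dab : mderiv j a * q = mderiv j p * b + p * mderiv j b - a * mderiv j q.
  by apply/eqP; rewrite eq_sym subr_eq -!mderivM eab.
apply/eqP; rewrite eqr_div ?expf_neq0 ?tofrac_eq0 // -!tofracXn -!tofracM.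
rewrite tofrac_eq; apply/eqP.
have -> : (mderiv j a * b - a * mderiv j b) * q ^+ 2 =
  (mderiv j a * q) * (b * q) - (a * q) * (mderiv j b * q) by ring.
rewrite dab eab.
have -> : (mderiv j p * b + p * mderiv j b - a * mderiv j q) * (b * q) =
  (mderiv j p * b + p * mderiv j b) * (b * q) - (a * q) * (mderiv j q * b) by ring.
by rewrite eab; ring.
Qed.

Definition jacobian s (phi : 'I_s -> ratfun n K) : 'M[ratfun n K]_(s, n) :=
  \matrix_(i < s, j < n) ratderiv j (phi i).

End RationalFunctions.

Arguments ratfun_const {K n} f.

(* Main.v *)
Require Import Defs.
From HB Require Import structures.
From mathcomp Require Import all_boot all_algebra all_field.
From mathcomp Require Import mpoly ring.
From Stdlib Require Import ClassicalEpsilon.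

(* Write F = K(x), r for the rank of the Jacobian J and t for trdeg_K L.
   A K-derivation of F is determined by its values on x and it kills L iff it
   kills the phi_i, so the L-derivations of F form the kernel of J, of dimension
   n - r. Choose n - r of the variables, xs, on which this kernel embeds. Then F
   has no nonzero derivation over E = L(xs). If some a in F were not separable
   over E, one of the generators a, x_1, ..., x_n of F over E would not be
   separable over its predecessors; at the last such generator there is a nonzero
   E-derivation, which extends to F through the separable steps above it. So F
   is separable algebraic over L(xs), and the exchange property gives
   n <= t + (n - r), with xs a separating transcendence basis in case of equality.
   Conversely, a derivation of F over L that vanishes on a separating transcendence
   basis B vanishes, so n - r <= |B| <= n - t.

   Finite generation of L needs no transcendence degree: adjoining the generators
   of F one at a time reduces it to fields between k and k(a). *)

Set Implicit Arguments.
Unset Strict Implicit.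
Unset Printing Implicit Defensive.

Import GRing.Theory.
Local Open Scope ring_scope.

(** * Subfields given by predicates *)

Section SubfieldStructure.
Variables (F : fieldType) (k : F -> Prop).

(** Excluded middle makes [k] boolean, and the proof argument allows closure instances to be
    declared for it; thus [k] becomes a field type to which the general theory applies. *)
Definition subfield_pred (_ : is_subfield k) : {pred F} :=
  fun x => if excluded_middle_informative (k x) then true else false.

Hypothesis kP : is_subfield k.

Lemma subfield_predP x : reflect (k x) (x \in subfield_pred kP).
Proof.
by rewrite unfold_in /subfield_pred; case: excluded_middle_informative => h;
  constructor.
Qed.

Fact subfield_pred_closed : divring_closed (subfield_pred kP).
Proof.
case: kP => k1 kB kD; split=> [|x y /subfield_predP kx /subfield_predP ky|
  x y /subfield_predP kx /subfield_predP ky]; apply/subfield_predP => //.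
  exact: kB.
exact: kD.
Qed.

HB.instance Definition _ :=
  GRing.isDivringClosed.Build F (subfield_pred kP) subfield_pred_closed.

Record subfield_type := SubfieldType
  { subfield_val : F; _ : subfield_val \in subfield_pred kP }.

HB.instance Definition _ := [isSub for subfield_val].
HB.instance Definition _ := [Choice of subfield_type by <:].
HB.instance Definition _ := [SubChoice_isSubComUnitRing of subfield_type by <:].
HB.instance Definition _ := [SubComUnitRing_isSubIntegralDomain of subfield_type by <:].
HB.instance Definition _ := [SubIntegralDomain_isSubField of subfield_type by <:].

(** Division and gcds of polynomials over [k] are carried out over the field type and mapped back
    along this correspondence. *)
Lemma poly_overP p : poly_over k p <->
  exists q : {poly subfield_type}, p = map_poly val q.
Proof.
split=> [kp | [q ->] i]; last first.
  by rewrite coef_map /=; apply/subfield_predP/valP.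
exists (\poly_(i < size p) insubd 0 p`_i).
apply/polyP => i; rewrite coef_map coef_poly /=.
case: ltnP => [_|/leq_sizeP/(_ i (leqnn i)) ->]; last first.
  exact: (esym (rmorph0 (val : {rmorphism subfield_type -> F}))).
by rewrite insubdK //; apply/subfield_predP.
Qed.

End SubfieldStructure.

(** * Generated subfields, algebraic elements and minimal polynomials *)

Section SubfieldTheory.
Variable F : fieldType.
Implicit Types (k E S B : F -> Prop) (a b x y : F) (p q : {poly F}).

Lemma poly_overE k (kP : is_subfield k) p :
  poly_over k p <-> p \is a polyOver (subfield_pred kP).
Proof.
split=> [kp | /polyOverP kp i]; last exact/subfield_predP.
by apply/polyOverP => i; apply/subfield_predP.
Qed.

Lemma subfield0 k : is_subfield k -> k 0.
Proof. by move=> kP; apply/(subfield_predP kP)/rpred0. Qed.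

Lemma subfield1 k : is_subfield k -> k 1.
Proof. by case. Qed.

Lemma subfieldD k x y : is_subfield k -> k x -> k y -> k (x + y).
Proof.
by move=> kP /(subfield_predP kP) kx /(subfield_predP kP) ky;
  apply/(subfield_predP kP)/rpredD.
Qed.

Lemma subfieldM k x y : is_subfield k -> k x -> k y -> k (x * y).
Proof.
by move=> kP /(subfield_predP kP) kx /(subfield_predP kP) ky;
  apply/(subfield_predP kP)/rpredM.
Qed.

Lemma subfieldB k x y : is_subfield k -> k x -> k y -> k (x - y).
Proof. by case=> _ + _; apply. Qed.

Lemma subfield_div k x y : is_subfield k -> k x -> k y -> k (x / y).
Proof. by case=> _ _; apply. Qed.

Lemma subfieldX k x n : is_subfield k -> k x -> k (x ^+ n).
Proof.
by move=> kP /(subfield_predP kP) kx; apply/(subfield_predP kP)/rpredX.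
Qed.

Lemma subfield_sum k (I : Type) (r : seq I) (P : pred I) (f : I -> F) :
  is_subfield k -> (forall i, k (f i)) -> k (\sum_(i <- r | P i) f i).
Proof.
by move=> kP kf; apply/(subfield_predP kP)/rpred_sum => i _; apply/subfield_predP.
Qed.

Lemma subfield_horner k p x : is_subfield k -> poly_over k p -> k x -> k p.[x].
Proof.
move=> kP kp kx; apply/(subfield_predP kP)/rpred_horner.
  exact/poly_overE.
exact/subfield_predP.
Qed.

Lemma adjoin_subfield k S : is_subfield (adjoin k S).
Proof.
split=> [E [] // | x y kx ky E EP kE SE | x y kx ky E EP kE SE].
  by apply: subfieldB (kx _ _ _ _) (ky _ _ _ _).
by apply: subfield_div (kx _ _ _ _) (ky _ _ _ _).
Qed.

Lemma adjoin_base k S x : k x -> adjoin k S x.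
Proof. by move=> kx E _ kE _; apply: kE. Qed.

Lemma adjoin_gen k S x : S x -> adjoin k S x.
Proof. by move=> Sx E _ _; apply. Qed.

Lemma adjoin_sub k S E : is_subfield E -> (forall x, k x -> E x) ->
  (forall x, S x -> E x) -> forall x, adjoin k S x -> E x.
Proof. by move=> EP kE SE x; apply. Qed.

Lemma adjoin_mono k k' S S' : (forall x, k x -> k' x) ->
  (forall x, S x -> S' x) -> forall x, adjoin k S x -> adjoin k' S' x.
Proof.
move=> kk' SS'; apply: adjoin_sub; first exact: adjoin_subfield.
  by move=> x /kk'; apply: adjoin_base.
by move=> x /SS'; apply: adjoin_gen.
Qed.

Lemma algebraic_overE k (kP : is_subfield k) a : algebraic_over k a <->
  algebraicOver (val : subfield_type kP -> F) a.
Proof.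
split=> [[p [/(poly_overP kP)[q ->] q0 qa]] | [q q0 qa]].
  by exists q => //; rewrite map_poly_eq0 in q0.
exists (map_poly val q); split=> //; last by rewrite map_poly_eq0.
by apply/poly_overP; exists q.
Qed.

Lemma algebraic_base k a : is_subfield k -> k a -> algebraic_over k a.
Proof.
move=> kP ka; exists ('X - a%:P); split; last by rewrite root_XsubC.
  apply/(poly_overE kP); rewrite rpredB ?polyOverX ?polyOverC //.
  exact/subfield_predP.
exact: monic_neq0 (monicXsubC a).
Qed.

Lemma algebraic_mono k k' a : (forall x, k x -> k' x) ->
  algebraic_over k a -> algebraic_over k' a.
Proof.
by move=> kk' [p [kp p0 pa]]; exists p; split=> // i; apply/kk'/kp.
Qed.

Lemma algebraic_subfield k : is_subfield k -> is_subfield (algebraic_over k).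
Proof.
move=> kP; split=> [|x y|x y].
- by apply: algebraic_base => //; apply: subfield1.
- by rewrite !(algebraic_overE kP); apply: algebraic_sub.
- by rewrite !(algebraic_overE kP); apply: algebraic_div.
Qed.

(** Over a field, algebraic means integral, and integrality passes from the coefficients of a
    nonzero polynomial to its roots. *)
Lemma algebraic_trans k a : is_subfield k ->
  algebraic_over (algebraic_over k) a -> algebraic_over k a.
Proof.
move=> kP [p [kp p0 pa]]; apply/(algebraic_overE kP)/integral_algebraic.
apply: integral_root p0 pa _ => _ /(nthP 0)[i _ <-].
exact/integral_algebraic/algebraic_overE.
Qed.

Lemma algebraic_adjoin k k' S : is_subfield k' ->
  (forall x, k x -> algebraic_over k' x) ->
  (forall x, S x -> algebraic_over k' x) ->
  forall x, algebraic_over (adjoin k S) x -> algebraic_over k' x.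
Proof.
move=> k'P kk' Sk' x xkS; apply: algebraic_trans => //.
apply: algebraic_mono xkS; apply: adjoin_sub => //.
exact: algebraic_subfield.
Qed.

Lemma poly_over_modp k p q : is_subfield k ->
  poly_over k p -> poly_over k q -> poly_over k (p %% q).
Proof.
move=> kP /(poly_overP kP)[p' ->] /(poly_overP kP)[q' ->].
by apply/(poly_overP kP); exists (p' %% q'); rewrite map_modp.
Qed.

Lemma poly_over_divp k p q : is_subfield k ->
  poly_over k p -> poly_over k q -> poly_over k (p %/ q).
Proof.
move=> kP /(poly_overP kP)[p' ->] /(poly_overP kP)[q' ->].
by apply/(poly_overP kP); exists (p' %/ q'); rewrite map_divp.
Qed.

(** Strong induction on the size reaches a shortest nonzero annihilator; dividing by its leading
    coefficient makes it monic. *)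
Lemma min_poly_exists k a : is_subfield k -> algebraic_over k a ->
  exists p, is_min_poly k a p.
Proof.
move=> kP [p0 [kp0 p00 p0a]].
pose P n := exists p, [/\ poly_over k p, p != 0, root p a & size p = n].
have [n] : exists n, P n by exists (size p0), p0.
elim/ltn_ind: n => n IH [p [kp p_neq0 pa sz]].
have [[m ltmn Pm]|nex] := classic (exists2 m, (m < n)%N & P m); first exact: IH Pm.
have lc0 : (lead_coef p)^-1 != 0 by rewrite invr_eq0 lead_coef_eq0.
exists ((lead_coef p)^-1 *: p); split.
- apply/(poly_overE kP)/polyOverZ; last exact/poly_overE.
  rewrite rpredV; apply/subfield_predP; exact: kp.
- by rewrite monicE lead_coefZ mulVf ?lead_coef_eq0.
- by rewrite rootZ.
- move=> q kq q0 qa; rewrite size_scale // sz leqNgt; apply/negP => ltq.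
  by apply: nex; exists (size q) => //; exists q.
Qed.

Lemma min_poly_dvd k a m p : is_subfield k -> is_min_poly k a m ->
  poly_over k p -> root p a -> m %| p.
Proof.
move=> kP [km mmon ma mmin] kp pa; rewrite /dvdp; apply/eqP.
apply/eqP; apply/idPn => r0.
have rk := poly_over_modp kP kp km.
have ra : root (p %% m) a.
  have := pa; rewrite {1}(divp_eq p m) !rootE hornerD hornerM.
  by rewrite (rootP ma) mulr0 add0r.
have := mmin _ rk r0 ra; rewrite leqNgt ltn_modp.
by rewrite (monic_neq0 mmon).
Qed.

(* In the transcendental case [m = 0]. *)
Lemma annihilator_exists k a : is_subfield k -> exists m,
  [/\ poly_over k m, root m a &
      forall p, poly_over k p -> root p a -> m %| p].
Proof.
move=> kP; have [alg|nalg] := classic (algebraic_over k a).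
  have [m mP] := min_poly_exists kP alg; exists m; split; try by case: mP.
  by move=> p; apply: min_poly_dvd.
exists 0; split=> [i||p kp pa]; rewrite ?root0 ?coef0 //; first exact: subfield0.
by rewrite dvd0p; apply/idPn => p0; apply: nalg; exists p.
Qed.

End SubfieldTheory.

Lemma choice_fun (A B : Type) (R : A -> B -> Prop) :
  (forall x, exists y, R x y) -> exists f, forall x, R x (f x).
Proof.
move=> RP; exists (fun x => sval (constructive_indefinite_description _ (RP x))).
by move=> x; case: constructive_indefinite_description.
Qed.

(** * Exchange *)

Section AlgebraicDependence.
Variable F : fieldType.
Implicit Types (k E S T : F -> Prop) (a b c x y : F) (p q : {poly F}) (l s : seq F).

Definition is_subring S := [/\ S 1, forall x y, S x -> S y -> S (x - y)
  & forall x y, S x -> S y -> S (x * y)].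

(** As [adjoin] is an intersection of subfields, its elements get an explicit form by exhibiting a
    subfield: the fractions of elements of [S] form one. *)
Lemma adjoin_frac k T S : is_subring S ->
  (forall x, k x -> S x) -> (forall x, T x -> S x) ->
  forall a, adjoin k T a -> exists x y, [/\ S x, S y, y != 0 & a = x / y].
Proof.
move=> [S1 SB SM] kS TS; apply: adjoin_sub => [|x /kS Sx|x /TS Sx]; last first.
- by exists x, 1; rewrite oner_neq0 divr1.
- by exists x, 1; rewrite oner_neq0 divr1.
split.
- by exists 1, 1; rewrite oner_neq0 divr1.
- move=> _ _ [x1 [y1 [Sx1 Sy1 y10 ->]]] [x2 [y2 [Sx2 Sy2 y20 ->]]].
  exists (x1 * y2 - x2 * y1), (y1 * y2).
  rewrite mulf_neq0 //; split=> //; try by [apply: SB; apply: SM | apply: SM].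
  by rewrite -mulNr addf_div // mulNr.
- move=> _ _ [x1 [y1 [Sx1 Sy1 y10 ->]]] [x2 [y2 [Sx2 Sy2 y20 ->]]].
  have [->|x20] := eqVneq x2 0.
    (* Division by [0] yields [0], which is represented as [0 / 1]. *)
    exists 0, 1; rewrite oner_neq0 !mul0r invr0 mulr0 -(subrr 1).
    by split=> //; apply: SB.
  exists (x1 * y2), (y1 * x2).
  by rewrite mulf_neq0 // invf_div mulf_div; split=> //; apply: SM.
Qed.

Lemma common_denominator S p : is_subring S ->
  (forall i, exists x y, [/\ S x, S y, y != 0 & p`_i = x / y]) ->
  exists d, [/\ S d, d != 0 & forall i, S (d * p`_i)].
Proof.
move=> [S1 SB SM]; have S0 : S 0 by rewrite -(subrr 1); apply: SB.
elim/poly_ind: p => [_|p c IH pS].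
  by exists 1; rewrite oner_neq0; split=> // i; rewrite coef0 mulr0.
have [i|d [Sd d0 dp]] := IH.
  by have := pS i.+1; rewrite coefD coefMX coefC /= addr0.
have := pS 0; rewrite coefD coefMX coefC /= add0r => -[x [y [Sx Sy y0 cE]]].
exists (d * y); rewrite mulf_neq0 //; split=> //; first exact: SM.
case=> [|i]; rewrite coefD coefMX coefC /= ?add0r ?addr0.
  by rewrite cE -mulrA [y * _]mulrC divfK //; apply: SM.
by rewrite mulrAC; apply: SM.
Qed.

(** Multiplying by a common denominator moves the coefficients of an annihilator into [S]. *)
Lemma algebraic_adjoin_subring k T S a : is_subring S ->
  (forall x, k x -> S x) -> (forall x, T x -> S x) ->
  algebraic_over (adjoin k T) a ->
  exists p, [/\ forall i, S p`_i, p != 0 & root p a].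
Proof.
move=> SP kS TS [p [kp p0 pa]].
have [i|d [Sd d0 dp]] := @common_denominator S p SP.
  exact: adjoin_frac SP kS TS _ (kp i).
exists (d *: p); split=> [i||]; first by rewrite coefZ.
  by rewrite scaler_eq0 negb_or d0.
by rewrite rootZ.
Qed.

Definition adjoin_seq k l := adjoin k (fun x => x \in l).

Lemma adjoin_seq_subfield k l : is_subfield (adjoin_seq k l).
Proof. exact: adjoin_subfield. Qed.

Lemma adjoin_seq_base k l x : k x -> adjoin_seq k l x.
Proof. exact: adjoin_base. Qed.

Lemma adjoin_seq_gen k l x : x \in l -> adjoin_seq k l x.
Proof. exact: (@adjoin_gen _ k (fun y => y \in l)). Qed.

Lemma adjoin_seq_nil k x : is_subfield k -> adjoin_seq k [::] x -> k x.
Proof. by move=> kP; apply. Qed.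

Lemma adjoin_seq_sub k E l : is_subfield E -> (forall x, k x -> E x) ->
  (forall x, x \in l -> E x) -> forall x, adjoin_seq k l x -> E x.
Proof. by move=> EP kE lE x; apply; [|exact: kE|exact: lE]. Qed.

Lemma adjoin_seq_mono k k' l l' : (forall x, k x -> k' x) ->
  {subset l <= l'} -> forall x, adjoin_seq k l x -> adjoin_seq k' l' x.
Proof. by move=> kk' ll'; apply: adjoin_mono. Qed.

Lemma adjoin_seq_cat k l1 l2 x :
  adjoin_seq k (l1 ++ l2) x <-> adjoin_seq (adjoin_seq k l1) l2 x.
Proof.
split; move: x; apply: adjoin_seq_sub; try exact: adjoin_seq_subfield; move=> x.
- by move=> kx; do 2!apply: adjoin_seq_base.
- rewrite mem_cat => /orP[]; last exact: adjoin_seq_gen.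
  by move=> xl; apply: adjoin_seq_base; apply: adjoin_seq_gen.
- by apply: adjoin_seq_mono => // z zl; rewrite mem_cat zl.
- by move=> xl; apply: adjoin_seq_gen; rewrite mem_cat xl orbT.
Qed.

Lemma algebraic_seq_sub k k' l : is_subfield k' ->
  (forall x, k x -> algebraic_over k' x) ->
  (forall x, x \in l -> algebraic_over k' x) ->
  forall x, algebraic_over (adjoin_seq k l) x -> algebraic_over k' x.
Proof. by move=> k'P kk' lk'; apply: algebraic_adjoin. Qed.

Lemma horner_subring k b : is_subfield k ->
  is_subring (fun x => exists2 g, poly_over k g & x = g.[b]).
Proof.
move=> kP; split=> [|_ _ [g kg ->] [h kh ->]|_ _ [g kg ->] [h kh ->]].
- exists 1; rewrite ?hornerE //; apply/(poly_overE kP)/rpred1.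
- exists (g - h); rewrite ?hornerE //.
  by apply/(poly_overE kP)/rpredB; apply/(poly_overE kP).
- exists (g * h); rewrite ?hornerE //.
  by apply/(poly_overE kP)/rpredM; apply/(poly_overE kP).
Qed.

Lemma poly_overC k x : is_subfield k -> k x -> poly_over k x%:P.
Proof.
by move=> kP kx; apply/(poly_overE kP); rewrite polyOverC; apply/subfield_predP.
Qed.

Lemma poly_overX k : is_subfield k -> poly_over k 'X.
Proof. by move=> kP; apply/(poly_overE kP)/polyOverX. Qed.

Lemma horner_subring_base k b : is_subfield k ->
  forall x, k x -> exists2 g, poly_over k g & x = g.[b].
Proof.
by move=> kP x kx; exists x%:P; rewrite ?hornerE //; apply: poly_overC.
Qed.

Lemma horner_subring_gen k b : is_subfield k ->
  exists2 g, poly_over k g & b = g.[b].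
Proof. by move=> kP; exists 'X; rewrite ?hornerE //; apply: poly_overX. Qed.

Lemma adjoin1_frac k a x : is_subfield k -> adjoin_seq k [:: a] x ->
  exists p q, [/\ poly_over k p, poly_over k q, q.[a] != 0 & x = p.[a] / q.[a]].
Proof.
move=> kP kax.
have [||y [z [[p kp ->] [q kq ->] q0 ->]]] := adjoin_frac (horner_subring a kP) _ _ kax.
- exact: horner_subring_base.
- by move=> y; rewrite inE => /eqP ->; apply: horner_subring_gen.
- by exists p, q.
Qed.

(* A relation [P(a, b) = 0] over [k] is read as a polynomial in either variable. *)
Lemma algebraic_exchange k a b : is_subfield k ->
  ~ algebraic_over k a -> algebraic_over (adjoin_seq k [:: b]) a ->
  algebraic_over (adjoin_seq k [:: a]) b.
Proof.
move=> kP ka kba.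
have [||p [Sp p0 pa]] := algebraic_adjoin_subring (horner_subring b kP) _ _ kba.
- exact: horner_subring_base.
- by move=> x; rewrite inE => /eqP ->; apply: horner_subring_gen.
have [g gP] : exists g : nat -> {poly F},
    forall i, poly_over k (g i) /\ p`_i = (g i).[b].
  apply: (@choice_fun _ _ (fun i h => poly_over k h /\ p`_i = h.[b])) => i.
  by have [h] := Sp i; exists h.
pose P := \poly_(i < size p) g i.
pose q := map_poly (horner_eval a) (swapXY P).
have kQ j : poly_over k (swapXY P)`_j.
  move=> i; rewrite coef_swapXY coef_poly; case: ifP => _; first by case: (gP i).
  by rewrite coef0; apply: subfield0.
have Pb : map_poly (horner_eval b) P = p.
  apply/polyP => i; rewrite coef_map coef_poly /= /horner_eval.
  case: ltnP => [_|/leq_sizeP/(_ i (leqnn i)) ->]; last by rewrite horner0.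
  by case: (gP i).
exists q; split.
- move=> j; rewrite coef_map /= /horner_eval.
  apply: (@subfield_horner _ (adjoin_seq k [:: a])).
  + exact: adjoin_seq_subfield.
  + by move=> i; apply: adjoin_seq_base; apply: kQ.
  + by apply: adjoin_seq_gen; rewrite inE.
- apply/negP => /eqP/polyP q0; case/negP: p0; apply/eqP; rewrite -Pb.
  (* If [q = 0], each coefficient of [swapXY P] is a polynomial over [k] vanishing at the
     transcendental [a], hence is zero; then [P] and [p] vanish too. *)
  have Q0 : swapXY P = 0.
    apply/polyP => j; rewrite coef0; apply/eqP/idPn => Qj; apply: ka.
    exists (swapXY P)`_j; split=> //; apply/rootP.
    by have := q0 j; rewrite coef_map coef0.
  by move/eqP: Q0; rewrite swapXY_eq0 => /eqP ->; rewrite rmorph0.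
- rewrite rootE.
  (* Both orders of evaluation give [P(a, b)], so [q.[b] = p.[a] = 0]. *)
  have := horner_map (horner_eval a) (swapXY P) b%:P.
  have := horner_map (horner_eval b) P a%:P.
  rewrite Pb -/q /= /horner_eval !hornerC horner2_swapXY => <- ->.
  by rewrite -rootE.
Qed.

(** Sequential form of algebraic independence, suited to exchanging one element at a time while the
    base field grows. *)
Fixpoint seq_indep k l : Prop :=
  if l is a :: l' then ~ algebraic_over k a /\ seq_indep (adjoin_seq k [:: a]) l'
  else True.

(** Adjoining [l] from left to right, [c] is an element at which [a] turns from transcendental to
    algebraic. *)
Lemma algebraic_prefix k l a : is_subfield k ->
  ~ algebraic_over k a -> algebraic_over (adjoin_seq k l) a ->
  exists l1 c l2, [/\ l = l1 ++ c :: l2, ~ algebraic_over (adjoin_seq k l1) a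
    & algebraic_over (adjoin_seq (adjoin_seq k l1) [:: c]) a].
Proof.
move=> kP ka; elim/last_ind: l => [kal|l c IH kal].
  by case: ka; apply: algebraic_mono kal => x; apply: adjoin_seq_nil.
have [/IH[l1 [d [l2 [-> l1a da]]]]|la] := classic (algebraic_over (adjoin_seq k l) a).
  by exists l1, d, (rcons l2 c); rewrite rcons_cat.
exists l, c, [::]; rewrite -cats1; split=> //.
by apply: algebraic_mono kal => x; rewrite -cats1 adjoin_seq_cat.
Qed.

(** The head [b] of [l] is exchanged for some [c] of [s]; over the base [k(b)] both sequences are
    then one shorter. *)
Lemma steinitz k l s : is_subfield k -> seq_indep k l ->
  (forall x, x \in l -> algebraic_over (adjoin_seq k s) x) ->
  (size l <= size s)%N.
Proof.
elim: l k s => [//|b l IH] k s kP [kb lind] ls.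
have [|s1 [c [s2 [sE s1b cb]]]] := algebraic_prefix kP kb (ls b _).
  by rewrite inE eqxx.
have bc := algebraic_exchange (adjoin_seq_subfield _ _) s1b cb.
have kbP := adjoin_seq_subfield k [:: b].
suff: (size l <= size (s1 ++ s2))%N by rewrite sE !size_cat /= addnS.
apply: IH lind _ => // x xl.
have k'P := adjoin_seq_subfield (adjoin_seq k [:: b]) (s1 ++ s2).
have xs : algebraic_over (adjoin_seq k s) x by apply: ls; rewrite inE xl orbT.
apply: algebraic_seq_sub xs => // y.
  by move=> ky; apply: algebraic_base => //; do 2!apply: adjoin_seq_base.
rewrite sE mem_cat inE => /or3P[ys|/eqP ->|ys].
- by apply: algebraic_base => //; apply: adjoin_seq_gen; rewrite mem_cat ys.
(* The removed [c] is algebraic over [k(s1)(b)], which lies in [k(b)(s1 ++ s2)]. *)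
- apply: algebraic_mono bc; apply: adjoin_seq_sub => // z.
    apply: adjoin_seq_mono => [u ku|u us]; first exact: adjoin_seq_base.
    by rewrite mem_cat us.
  by move=> zb; apply: adjoin_seq_base; apply: adjoin_seq_gen.
- by apply: algebraic_base => //; apply: adjoin_seq_gen; rewrite mem_cat ys orbT.
Qed.

End AlgebraicDependence.

(** * Algebraic independence *)

Section LastVariable.
Variables (n : nat) (R : comNzRingType).
Implicit Types (p : {mpoly R[n.+1]}) (m : 'X_{1..n.+1}).

Let widen := (widen_ord (leqnSn n)).

Lemma lift_ord_max (j : 'I_n) : lift ord_max j = widen j.
Proof. by apply/val_inj; rewrite /= /bump leqNgt ltn_ord. Qed.

Definition mnm_init m : 'X_{1..n} := [multinom m (widen i) | i < n].

Lemma mnm_init_inj m m' : mnm_init m = mnm_init m' -> m ord_max = m' ord_max ->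
  m = m'.
Proof.
move=> /mnmP mm' maxE; apply/mnmP => i.
case: (unliftP ord_max i) => [j ->|-> //].
by have := mm' j; rewrite !mnmE lift_ord_max.
Qed.

Lemma muniX m : muni ('X_[m] : {mpoly R[n.+1]}) = 'X_[mnm_init m] *: 'X^(m ord_max).
Proof. by rewrite muniE msuppX big_seq1 mcoeffX eqxx scale1r. Qed.

Lemma mcoeff_muni p m : (muni p)`_(m ord_max)@_(mnm_init m) = p@_m.
Proof.
elim/mpolyind: p => [|c m' p _ _ IH]; first by rewrite muni0 coef0 !mcoeff0.
rewrite muniD muniZ muniX coefD !coefZ !mcoeffD IH coefXn mcoeffCM mcoeffZ mcoeffX.
congr (c * _ + _); rewrite mulr_natr mcoeffMn mcoeffX -mulrnA mulnb.
congr ((nat_of_bool _)%:R).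
apply/idP/idP => [/andP[/eqP h /eqP h']|/eqP ->]; last by rewrite !eqxx.
by apply/eqP/mnm_init_inj.
Qed.

(** Ensures that reading [p] as a polynomial in its last variable keeps the coefficients in a given
    subfield. *)
Lemma mcoeff_muni_rcons p i (u : 'X_{1..n}) : exists m,
  (muni p)`_i@_u = p@_m.
Proof.
pose m := [multinom (if unlift ord_max j is Some j' then u j' else i) | j < n.+1].
have mi : m ord_max = i by rewrite mnmE unlift_none.
have mu : mnm_init m = u.
  by apply/mnmP => j; rewrite !mnmE -lift_ord_max liftK.
by exists m; rewrite -mcoeff_muni mi mu.
Qed.

Lemma meval_muni p (b : 'I_n.+1 -> R) :
  p.@[b] = (map_poly (meval (b \o widen)) (muni p)).[b ord_max].
Proof.
elim/mpolyind: p => [|c m p _ _ IH]; first by rewrite muni0 meval0 rmorph0 horner0.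
rewrite muniD muniZ muniX mevalD rmorphD hornerD -IH mevalZ; congr (_ + _).
rewrite -!mul_polyC !rmorphM /= !map_polyC map_polyXn !hornerM !hornerC hornerXn /=.
rewrite mevalC !mevalX; congr (_ * _).
by rewrite big_ord_recr /=; congr (_ * _); apply: eq_bigr => i _; rewrite mnmE.
Qed.

Lemma muni_mwiden (q : {mpoly R[n]}) : muni (mwiden q) = q%:P.
Proof.
elim/mpolyind: q => [|c m q _ _ IH]; first by rewrite mwiden0 muni0.
rewrite mwidenD muniD IH mwidenZ muniZ mwidenX muniX mnmwiden_ordmax expr0 polyCD.
congr (_ + _); rewrite -mul_mpolyC polyCM -!mul_polyC mulr1; congr (_ * (polyC 'X_[_])).
by apply/mnmP => i; rewrite mnmE mnmwiden_widen.
Qed.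

Lemma mmultiK : cancel (@mmulti n R) (@muni n R).
Proof.
move=> P; rewrite /mmulti raddf_sum /= -[RHS]coefK poly_def.
apply: eq_bigr => i _; rewrite muniM muni_mwiden rmorphXn /= mul_polyC.
congr (_ *: _ ^+ _); rewrite muniX mnmE eqxx expr1.
have -> : mnm_init U_(ord_max) = 0%MM.
  apply/mnmP => j; rewrite !mnmE -val_eqE /=.
  by rewrite gtn_eqF ?ltn_ord.
by rewrite mpolyX0 scale1r.
Qed.

End LastVariable.

Section AlgebraicIndependence.
Variable F : fieldType.
Implicit Types (k E S B : F -> Prop) (a b x y : F) (l s : seq F).

Lemma mpoly_overE k (kP : is_subfield k) m (p : {mpoly F[m]}) :
  mpoly_over k p <-> p \is a mpolyOver m (subfield_pred kP).
Proof.
split=> [kp | /mpolyOverP kp i]; last exact/subfield_predP.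
by apply/mpolyOverP => i; apply/subfield_predP.
Qed.

Lemma subfield_meval k m (p : {mpoly F[m]}) (b : 'I_m -> F) :
  is_subfield k -> mpoly_over k p -> (forall i, k (b i)) -> k p.@[b].
Proof.
move=> kP /(mpoly_overE kP) kp kb; apply/(subfield_predP kP)/rpred_mhorner => //.
by apply/forallP => i; apply/subfield_predP.
Qed.

(** The condition of [alg_independent] for one family, which permits induction on the last
    variable. *)
Definition eval_free k m (b : 'I_m -> F) : Prop :=
  forall p : {mpoly F[m]}, mpoly_over k p -> p.@[b] = 0 -> p = 0.

(** Read [p] as a polynomial in the last variable. Since the last entry is transcendental over the
    others, every coefficient vanishes at the shorter family, hence is zero by induction. *)
Lemma eval_free_prefix k m (b : 'I_m -> F) : is_subfield k ->
  (forall i : 'I_m, ~ algebraic_over (adjoin k (fun x => exists2 j,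
     (nat_of_ord j < nat_of_ord i)%N & x = b j)) (b i)) ->
  eval_free k b.
Proof.
move=> kP; elim: m b => [|m IH] b bind p kp pb.
  by move: pb; rewrite (nvar0_mpolyC p) mevalC => ->; rewrite mpolyC0.
set widen := widen_ord (leqnSn m).
have kuni i : mpoly_over k (muni p)`_i.
  by move=> u; have [v ->] := mcoeff_muni_rcons p i u.
pose q := map_poly (meval (b \o widen)) (muni p).
have q0 : q = 0.
  apply/eqP/idPn => q0; apply: (bind ord_max); exists q; split=> //.
    move=> i; rewrite coef_map /=; apply: subfield_meval.
    - exact: adjoin_subfield.
    - by move=> u; apply: adjoin_base; apply: kuni.
    - by move=> j; apply: adjoin_gen; exists (widen j); rewrite /= ?ltn_ord.
  by rewrite rootE -meval_muni pb.
apply/mpolyP => u; rewrite -mcoeff_muni mcoeff0.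
rewrite (IH (b \o widen) _ (muni p)`_(u ord_max)) ?mcoeff0 //.
  move=> i; apply: contra_not (bind (widen i)) => bi.
  apply: algebraic_mono bi; apply: adjoin_mono => // _ [j ji ->].
  by exists (widen j).
by move/polyP: q0 => /(_ (u ord_max)); rewrite coef_map coef0.
Qed.

(** An element transcendental over all the others is transcendental over its predecessors in any
    injective enumeration. *)
Lemma alg_independent_minimal k B : is_subfield k ->
  (forall a, B a -> ~ algebraic_over (adjoin k (fun x => B x /\ x <> a)) a) ->
  alg_independent k B.
Proof.
move=> kP Bmin m b binj bB; apply: eval_free_prefix => // i.
apply: contra_not (Bmin _ (bB i)) => bi; apply: algebraic_mono bi.
apply: adjoin_mono => // _ [j ji ->]; split=> // /binj jE.
by rewrite jE ltnn in ji.
Qed.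

Lemma eval_free_widen k m (b : 'I_m.+1 -> F) : is_subfield k ->
  eval_free k b -> eval_free k (b \o widen_ord (leqnSn m)).
Proof.
move=> kP bfree p kp pb; apply: inj_mwiden; rewrite mwiden0; apply: bfree.
  move=> u; rewrite -mcoeff_muni muni_mwiden coefC; case: ifP => _ //.
  by rewrite mcoeff0; apply: subfield0.
by rewrite meval_muni muni_mwiden map_polyC hornerC.
Qed.

(** After clearing denominators, the coefficients of an annihilator are polynomial values at the
    first [m] entries; lifting them gives a nonzero relation in [m.+1] variables. *)
Lemma eval_free_last k m (b : 'I_m.+1 -> F) : is_subfield k -> eval_free k b ->
  ~ algebraic_over (adjoin k (fun x => exists i, x = b (widen_ord (leqnSn m) i)))
      (b ord_max).
Proof.
move=> kP bfree alg; pose b' := b \o widen_ord (leqnSn m).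
pose S x := exists2 g : {mpoly F[m]}, mpoly_over k g & x = g.@[b'].
have SP : is_subring S.
  split=> [|_ _ [g kg ->] [h kh ->]|_ _ [g kg ->] [h kh ->]].
  - exists 1; rewrite ?meval1 //; apply/(mpoly_overE kP)/rpred1.
  - exists (g - h); rewrite ?mevalB //.
    by apply/(mpoly_overE kP)/rpredB; apply/(mpoly_overE kP).
  - exists (g * h); rewrite ?mevalM //.
    by apply/(mpoly_overE kP)/rpredM; apply/(mpoly_overE kP).
have [||p [Sp p0 pa]] := algebraic_adjoin_subring SP _ _ alg.
- move=> x kx; exists x%:MP; rewrite ?mevalC //.
  by apply/(mpoly_overE kP); rewrite mpolyOverC; apply/subfield_predP.
- move=> _ [i ->]; exists 'X_i; first exact/(mpoly_overE kP)/mpolyOverX.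
  by rewrite mevalXU.
have [g gP] : exists g : nat -> {mpoly F[m]},
    forall i, mpoly_over k (g i) /\ p`_i = (g i).@[b'].
  apply: (@choice_fun _ _ (fun i h => mpoly_over k h /\ p`_i = h.@[b'])) => i.
  by have [h] := Sp i; exists h.
pose P := \poly_(i < size p) g i.
have Pp : map_poly (meval b') P = p.
  apply/polyP => i; rewrite coef_map coef_poly /=.
  case: ltnP => [_|/leq_sizeP/(_ i (leqnn i)) ->]; last by rewrite meval0.
  by case: (gP i).
have kP' i : mpoly_over k P`_i.
  move=> u; rewrite coef_poly; case: ifP => _; first by case: (gP i).
  by rewrite mcoeff0; apply: subfield0.
have G0 : mmulti P = 0.
  apply: bfree; last by rewrite meval_muni mmultiK -/b' Pp; apply/rootP.
  move=> u; rewrite -mcoeff_muni mmultiK; exact: kP'.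
by case/negP: p0; rewrite -Pp -[P]mmultiK G0 muni0 rmorph0.
Qed.

Lemma seq_indep_mono k k' l : (forall x, k x -> k' x) ->
  seq_indep k' l -> seq_indep k l.
Proof.
elim: l k k' => [//|a l IH] k k' kk' [k'a k'l]; split.
  by apply: contra_not k'a; apply: algebraic_mono.
by apply: IH k'l; apply: adjoin_seq_mono.
Qed.

Lemma seq_indep_cat k l1 l2 : is_subfield k -> seq_indep k l1 ->
  seq_indep (adjoin_seq k l1) l2 -> seq_indep k (l1 ++ l2).
Proof.
elim: l1 k => [|a l1 IH] k kP /=.
  by move=> _; apply: seq_indep_mono => x; apply: adjoin_seq_base.
move=> [ka kl1] kl2; split=> //; apply: IH => //; first exact: adjoin_seq_subfield.
by apply: seq_indep_mono kl2 => x; rewrite -adjoin_seq_cat.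
Qed.

Lemma eval_free_seq k m (b : 'I_m -> F) : is_subfield k -> eval_free k b ->
  seq_indep k [seq b i | i <- enum 'I_m].
Proof.
move=> kP; elim: m b => [|m IH] b bfree; first by rewrite enum_ord0.
rewrite enum_ordSr map_rcons -cats1 -map_comp.
apply: seq_indep_cat => //; first exact/IH/eval_free_widen.
split=> // alg; apply: (eval_free_last kP bfree); apply: algebraic_mono alg.
by apply: adjoin_mono => // _ /mapP[i _ ->]; exists i.
Qed.

Lemma alg_independent_seq k B l : is_subfield k -> alg_independent k B ->
  uniq l -> (forall x, x \in l -> B x) -> seq_indep k l.
Proof.
move=> kP Bind uniql lB.
have <- : [seq nth 0 l (i : 'I_(size l)) | i <- enum 'I_(size l)] = l.
  by rewrite -[RHS](mkseq_nth 0) /mkseq -val_enum_ord -map_comp.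
apply: eval_free_seq => // p; apply: Bind.
  by move=> i j /eqP; rewrite nth_uniq // => /eqP; apply: val_inj.
by move=> i; apply/lB/mem_nth.
Qed.

End AlgebraicIndependence.

(** * Finite generation of intermediate fields *)

Section FiniteGeneration.
Variable F : fieldType.
Implicit Types (k E : F -> Prop) (a x : F) (l : seq F).

Lemma adjoin_seq_horner k (p : {poly F}) a l : (forall x, x \in a :: p -> x \in l) ->
  adjoin_seq k l p.[a].
Proof.
move=> pl; apply: (@subfield_horner _ (adjoin_seq k l)).
- exact: adjoin_seq_subfield.
- move=> i; have [ip|pi] := ltnP i (size p).
    by apply: adjoin_seq_gen; apply: pl; rewrite inE mem_nth ?orbT.
  rewrite nth_default //; apply: (@subfield0 _ (adjoin_seq k l)).
  exact: adjoin_seq_subfield.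
- by apply: adjoin_seq_gen; apply: pl; rewrite inE eqxx.
Qed.

(* [E] is generated by the coefficients of the minimal polynomial of [a] over [E]
   (by nothing if [a] is transcendental over [E]): if [e = p(a) / q(a)], reduce [p]
   and [q] modulo it; then [e q - p] vanishes identically. *)
Lemma intermediate_simple_fg k E a : is_subfield k -> is_subfield E ->
  (forall x, k x -> E x) -> (forall x, E x -> adjoin_seq k [:: a] x) ->
  exists2 l, (forall x, x \in l -> E x) & forall x, E x -> adjoin_seq k l x.
Proof.
move=> kP EP kE Eka; have [m [Em ma m_dvd]] := annihilator_exists a EP.
exists (polyseq m) => [_ /(nthP 0)[i _ <-] // | e Ee].
have [p [q [kp kq q0 eE]]] := adjoin1_frac kP (Eka _ Ee).
have E0P := adjoin_seq_subfield k m; set E0 := adjoin_seq k m in E0P *.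
have E0m : poly_over E0 m.
  move=> i; have [im|mi] := ltnP i (size m).
    by apply: adjoin_seq_gen; apply: mem_nth.
  by rewrite nth_default //; apply: subfield0.
have E0mod r : poly_over k r -> poly_over E0 (r %% m).
  by move=> kr; apply: poly_over_modp => // i; apply: adjoin_seq_base; apply: kr.
have E0E x : E0 x -> E x.
  by apply: adjoin_seq_sub => // _ /(nthP 0)[i _ <-].
have hmod r : (r %% m).[a] = r.[a].
  by rewrite [in RHS](divp_eq r m) hornerD hornerM (rootP ma) mulr0 add0r.
pose r := e *: (q %% m) - p %% m.
have r0 : r = 0.
  have m_r : m %| r.
    apply: m_dvd.
      move=> i; rewrite coefB coefZ; apply: subfieldB => //; last first.
        by apply: E0E; apply: E0mod.
      by apply: subfieldM => //; apply: E0E; apply: E0mod.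
    by rewrite rootE !hornerE !hmod eE divfK ?subrr.
  (* In the transcendental case divisibility by [0] already gives [r = 0]; otherwise [r] is shorter
     than its divisor [m]. *)
  have [m0|m0] := eqVneq m 0; first by apply/eqP; rewrite m0 dvd0p in m_r.
  apply/eqP/idPn => r_neq0; have := dvdp_leq r_neq0 m_r; rewrite leqNgt.
  by rewrite (leq_ltn_trans (size_polyD _ _)) // gtn_max size_polyN ltn_modp m0
    (leq_ltn_trans (size_scale_leq _ _)) ?ltn_modp.
have qm0 : q %% m != 0 by apply: contraNneq q0 => qm0; rewrite -hmod qm0 horner0.
(* The coefficient of [r = 0] at the degree of [q %% m] expresses [e] through coefficients lying in
   [E0]. *)
have -> : e = (p %% m)`_(size (q %% m)).-1 / lead_coef (q %% m).
  apply: (canRL (mulfK _)); first by rewrite lead_coef_eq0.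
  by move/polyP: r0 => /(_ (size (q %% m)).-1); rewrite coefB coefZ coef0 => /subr0_eq.
by apply: (@subfield_div _ E0) => //; apply: E0mod.
Qed.

(** Each member of [l] is a fraction [p(a) / q(a)] over [E]; [l'] collects the finitely many
    coefficients involved. *)
Lemma adjoin1_fin k E a l : is_subfield E ->
  (forall x, x \in l -> adjoin_seq E [:: a] x) ->
  exists2 l', (forall x, x \in l' -> E x) &
    forall x, x \in l -> adjoin_seq (adjoin_seq k l') [:: a] x.
Proof.
move=> EP; elim: l => [|x l IH] lE; first by exists [::].
have [|l' l'E ll'] := IH; first by move=> y yl; apply: lE; rewrite inE yl orbT.
have [|p [q [Ep Eq _ xE]]] := @adjoin1_frac _ _ a x EP.
  by apply: lE; rewrite inE eqxx.
exists (polyseq p ++ polyseq q ++ l') => [y|y].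
  by rewrite !mem_cat => /or3P[/(nthP 0)[i _ <-]|/(nthP 0)[i _ <-]|/l'E].
rewrite inE => /predU1P[->|/ll'].
  rewrite xE -adjoin_seq_cat; apply: (@subfield_div _ (adjoin_seq k _)).
    exact: adjoin_seq_subfield.
    by apply: adjoin_seq_horner => z; rewrite inE !mem_cat inE => /orP[]->;
      rewrite ?orbT.
  by apply: adjoin_seq_horner => z; rewrite inE !mem_cat inE => /orP[]->;
      rewrite ?orbT.
apply: adjoin_seq_mono => // z; apply: adjoin_seq_mono => // u ul'.
by rewrite !mem_cat ul' !orbT.
Qed.

(** By induction [E(a)] is generated over [k(a)] by a finite [l1]. Expressing [l1] through [a] and a
    finite [l2] in [E] puts [E] between [k(l2)] and [k(l2)(a)], which is the simple case. *)
Lemma intermediate_fg k E l : is_subfield k -> is_subfield E ->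
  (forall x, k x -> E x) -> (forall x, E x -> adjoin_seq k l x) ->
  exists2 l', (forall x, x \in l' -> E x) & forall x, E x -> adjoin_seq k l' x.
Proof.
elim: l k E => [|a l IH] k E kP EP kE Ekl.
  by exists [::].
have [||l1 l1E El1] := IH _ _ (adjoin_seq_subfield k [:: a])
    (adjoin_seq_subfield E [:: a]).
- exact: adjoin_seq_mono.
- apply: adjoin_seq_sub; first exact: adjoin_seq_subfield.
    by move=> x /Ekl; rewrite -adjoin_seq_cat.
  by move=> x xa; apply: adjoin_seq_base; apply: adjoin_seq_gen.
have [l2 l2E l12] := adjoin1_fin k EP l1E.
have E1P := adjoin_seq_subfield k l2.
have [|x Ex|l3 l3E El3] := @intermediate_simple_fg _ _ a E1P EP.
- exact: adjoin_seq_sub.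
- apply: (@adjoin_seq_sub _ (adjoin_seq k [:: a]) _ l1); first exact: adjoin_seq_subfield.
  + by apply: adjoin_seq_mono => // y; apply: adjoin_seq_base.
  + exact: l12.
  + by apply: El1; apply: adjoin_seq_base.
exists (l2 ++ l3) => x; first by rewrite mem_cat => /orP[/l2E|/l3E].
by move=> /El3; rewrite adjoin_seq_cat.
Qed.

End FiniteGeneration.

(** * Extension of derivations *)

Section Derivations.
Variable F : fieldType.
Implicit Types (k E : F -> Prop) (a u x y : F) (l : seq F) (p q : {poly F}).
Implicit Types (D : F -> F).

(** Derivations from [E] to [F]: [D] is a total function, but its values outside [E] carry no
    information. *)
Definition is_derivation E D : Prop :=
  (forall x y, E x -> E y -> D (x + y) = D x + D y) /\
  (forall x y, E x -> E y -> D (x * y) = D x * y + x * D y).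

Lemma derivation_mono E E' D : (forall x, E x -> E' x) ->
  is_derivation E' D -> is_derivation E D.
Proof.
by move=> EE' [DD DM]; split=> x y /EE' Ex /EE' Ey; [apply: DD | apply: DM].
Qed.

Section OneDerivation.
Variables (E : F -> Prop) (D : F -> F).
Hypotheses (EP : is_subfield E) (DP : is_derivation E D).

Lemma derivation0 : D 0 = 0.
Proof.
have E0 := subfield0 EP; case: DP => DD _; have := DD 0 0 E0 E0.
by rewrite addr0 -[LHS]addr0 => /addrI.
Qed.

Lemma derivation1 : D 1 = 0.
Proof.
have E1 := subfield1 EP; case: DP => _ DM; have := DM 1 1 E1 E1.
by rewrite !mulr1 mul1r -[LHS]addr0 => /addrI.
Qed.

Lemma derivationB x y : E x -> E y -> D (x - y) = D x - D y.
Proof.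
move=> Ex Ey; case: DP => DD _; apply/eqP; rewrite eq_sym subr_eq; apply/eqP.
by rewrite -DD ?subrK //; apply: subfieldB.
Qed.

Lemma derivation_sum n (f : 'I_n -> F) : (forall i, E (f i)) ->
  D (\sum_(i < n) f i) = \sum_(i < n) D (f i).
Proof.
case: DP => DD _; elim: n f => [|n IH] f Ef; first by rewrite !big_ord0 derivation0.
rewrite !big_ord_recr /= DD ?IH //.
exact: subfield_sum.
Qed.

Lemma derivation_div x y : E x -> E y -> D x = 0 -> D y = 0 -> D (x / y) = 0.
Proof.
move=> Ex Ey Dx Dy; case: DP => _ DM.
have [->|y0] := eqVneq y 0; first by rewrite invr0 mulr0 derivation0.
apply: (mulIf y0); rewrite mul0r.
have := DM (x / y) y (subfield_div EP Ex Ey) Ey.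
by rewrite divfK // Dx Dy mulr0 addr0.
Qed.

(* [dhorner] is forced on [p(a)] by any extension of [D] with [a |-> u]. *)
Definition dhorner a u p := (map_poly D p).[a] + p^`().[a] * u.

Lemma coef_derivation p i : (map_poly D p)`_i = D p`_i.
Proof. by rewrite coef_map_id0 // derivation0. Qed.

Lemma dhornerD a u p q : poly_over E p -> poly_over E q ->
  dhorner a u (p + q) = dhorner a u p + dhorner a u q.
Proof.
case: DP => DD _ Ep Eq; rewrite /dhorner derivD hornerD.
have -> : map_poly D (p + q) = map_poly D p + map_poly D q.
  by apply/polyP => i; rewrite coefD !coef_derivation coefD DD.
by rewrite hornerD; ring.
Qed.

Lemma dhornerM a u p q : poly_over E p -> poly_over E q ->
  dhorner a u (p * q) = dhorner a u p * q.[a] + p.[a] * dhorner a u q.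
Proof.
case: DP => _ DM Ep Eq; rewrite /dhorner derivM !hornerD !hornerM.
have -> : map_poly D (p * q) = map_poly D p * q + p * map_poly D q.
  apply/polyP => i; rewrite coefD coef_derivation !coefM derivation_sum.
    rewrite -big_split /=; apply: eq_bigr => j _.
    by rewrite DM // !coef_derivation.
  by move=> j; apply: subfieldM.
by rewrite !hornerE; ring.
Qed.

Lemma dhornerC a u x : dhorner a u x%:P = D x.
Proof.
rewrite /dhorner derivC horner0 mul0r addr0.
have -> : map_poly D x%:P = (D x)%:P; last by rewrite hornerC.
by apply/polyP => i; rewrite coef_derivation !coefC; case: eqP; rewrite ?derivation0.
Qed.

Lemma dhornerX a u : dhorner a u 'X = u.
Proof.
rewrite /dhorner derivX hornerC mul1r.
have -> : map_poly D 'X = 0; last by rewrite horner0 add0r.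
apply/polyP => i; rewrite coef_derivation coefX coef0.
by case: eqP => _; rewrite ?derivation0 ?derivation1.
Qed.

Lemma dhornerB a u p q : poly_over E p -> poly_over E q ->
  dhorner a u (p - q) = dhorner a u p - dhorner a u q.
Proof.
move=> Ep Eq; apply/eqP; rewrite eq_sym subr_eq; apply/eqP.
rewrite -dhornerD ?subrK //.
by apply/(poly_overE EP)/rpredB; apply/(poly_overE EP).
Qed.

Lemma derivation_horner a p : E a -> poly_over E p ->
  D p.[a] = dhorner a (D a) p.
Proof.
case: DP => DD DM Ea; elim/poly_ind: p => [|p c IH] Ep.
  by rewrite horner0 /dhorner map_poly0 deriv0 !horner0 mul0r addr0 derivation0.
have Ec : E c by have := Ep 0; rewrite coefD coefMX coefC add0r.
have Ep' : poly_over E p.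
  by move=> i; have := Ep i.+1; rewrite coefD coefMX coefC addr0.
have EX := poly_overX EP; have Epa := subfield_horner EP Ep' Ea.
have EpX : poly_over E (p * 'X) by apply/(poly_overE EP)/rpredM; apply/(poly_overE EP).
rewrite dhornerD ?dhornerM ?dhornerX ?dhornerC -?IH //; last exact: poly_overC.
by rewrite !hornerE DD ?DM //; apply: subfieldM.
Qed.

(** The extension is defined on fractions [p(a) / q(a)] by the quotient rule; the hypothesis makes
    it independent of the chosen fraction. *)
Lemma derivation_extend1 a u :
  (forall p, poly_over E p -> root p a -> dhorner a u p = 0) ->
  exists D', [/\ is_derivation (adjoin_seq E [:: a]) D',
    forall x, E x -> D' x = D x & D' a = u].
Proof.
move=> Droot.
(* [R f g] says that [g] is the value forced at [f] by differentiating [p(a) = f q(a)]. *)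
pose R f g := exists p q, [/\ poly_over E p, poly_over E q, q.[a] != 0,
  p.[a] = f * q.[a] & dhorner a u p = f * dhorner a u q + g * q.[a]].
have Rex f : exists g, adjoin_seq E [:: a] f -> R f g.
  have [Ef|nEf] := classic (adjoin_seq E [:: a] f); last by exists 0.
  have [p [q [Ep Eq q0 fE]]] := adjoin1_frac EP Ef.
  exists ((dhorner a u p - f * dhorner a u q) / q.[a]) => _; exists p, q.
  by split=> //; rewrite ?divfK // ?fE ?divfK //; ring.
have polyM p q : poly_over E p -> poly_over E q -> poly_over E (p * q).
  by move=> Ep Eq; apply/(poly_overE EP)/rpredM; apply/(poly_overE EP).
have Runiq f g h : R f g -> R f h -> g = h.
  move=> [p1 [q1 [Ep1 Eq1 q10 f1 g1]]] [p2 [q2 [Ep2 Eq2 q20 f2 g2]]].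
  (* This polynomial vanishes at [a], and its [dhorner] expands to [(g - h) q1(a) q2(a)]. *)
  have : dhorner a u (p1 * q2 - p2 * q1) = 0.
    apply: Droot; last first.
      by rewrite rootE !(hornerD, hornerN, hornerM) f1 f2; apply/eqP; ring.
    apply/(poly_overE EP)/rpredB; apply/(poly_overE EP); exact: polyM.
  rewrite dhornerB ?dhornerM //; try exact: polyM.
  rewrite f1 f2 g1 g2 => h0; apply/eqP; rewrite -subr_eq0; apply/eqP.
  apply: (mulIf (mulf_neq0 q10 q20)); rewrite mul0r -[RHS]h0; ring.
have [D' D'P] := choice_fun Rex.
have D'E f g : R f g -> adjoin_seq E [:: a] f -> D' f = g.
  by move=> Rg /D'P Rf; apply: Runiq Rf Rg.
have E1 : poly_over E 1 by apply/(poly_overE EP)/rpred1.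
have d1 : dhorner a u 1 = 0 by rewrite -[1]/(1%:P) dhornerC derivation1.
exists D'; split.
- split=> f1 f2 Ef1 Ef2.
    apply: D'E; last exact: subfieldD (adjoin_seq_subfield _ _) Ef1 Ef2.
    have [p1 [q1 [Ep1 Eq1 q10 fE1 g1]]] := D'P _ Ef1.
    have [p2 [q2 [Ep2 Eq2 q20 fE2 g2]]] := D'P _ Ef2.
    exists (p1 * q2 + p2 * q1), (q1 * q2).
    have Epq : poly_over E (p1 * q2 + p2 * q1).
      by apply/(poly_overE EP)/rpredD; apply/(poly_overE EP); apply: polyM.
    split=> //; [exact: polyM|by rewrite hornerM mulf_neq0| |].
      rewrite !(hornerD, hornerM) fE1 fE2; ring.
    rewrite dhornerD ?dhornerM //; try exact: polyM.
    rewrite !(hornerD, hornerM) fE1 fE2 g1 g2; ring.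
  apply: D'E; last exact: subfieldM (adjoin_seq_subfield _ _) Ef1 Ef2.
  have [p1 [q1 [Ep1 Eq1 q10 fE1 g1]]] := D'P _ Ef1.
  have [p2 [q2 [Ep2 Eq2 q20 fE2 g2]]] := D'P _ Ef2.
  exists (p1 * p2), (q1 * q2).
  split; [exact: polyM|exact: polyM|by rewrite hornerM mulf_neq0| |].
    by rewrite !(hornerD, hornerM) fE1 fE2; ring.
  rewrite !dhornerM // !(hornerD, hornerM) fE1 fE2 g1 g2; ring.
- move=> x Ex; apply: D'E; last exact: adjoin_seq_base.
  exists x%:P, 1; rewrite dhornerC d1 !hornerE oner_neq0.
  by split=> //; exact: poly_overC.
- apply: D'E; last by apply: adjoin_seq_gen; rewrite inE.
  exists 'X, 1; rewrite dhornerX d1 !hornerE oner_neq0.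
  by split=> //; exact: poly_overX.
Qed.

End OneDerivation.

(** Separability in the form that derivations detect, with no minimal polynomial to choose;
    [separable_overP] gives the equivalence. *)
Definition simple_root_over E a :=
  exists p, [/\ poly_over E p, root p a & p^`().[a] != 0].

Lemma simple_root_algebraic E a : simple_root_over E a -> algebraic_over E a.
Proof.
move=> [p [Ep pa p'a]]; exists p; split=> //.
by apply: contraNneq p'a => ->; rewrite deriv0 horner0.
Qed.

Lemma simple_root_min_poly E a : is_subfield E -> simple_root_over E a ->
  exists m, is_min_poly E a m /\ m^`().[a] != 0.
Proof.
move=> EP sr; have [m mP] := min_poly_exists EP (simple_root_algebraic sr).
have [p [Ep pa p'a]] := sr.
exists m; split=> //; have /dvdpP[q pE] := min_poly_dvd EP mP Ep pa.
have [_ _ ma _] := mP; apply: contraNneq p'a => m'a.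
by rewrite pE derivM !hornerE (rootP ma) m'a !mulr0 addr0.
Qed.

(** For the converse, [g = gcd(m, m')] does not vanish at [a], so [m / g] still does; minimality of
    [m] forces [g] to be constant. *)
Lemma separable_overP E a : is_subfield E ->
  separable_over E a <-> simple_root_over E a.
Proof.
move=> EP; split=> [[p [[Ep _ pa _] psep]] | /(simple_root_min_poly EP)[m [mP m'a]]].
  exists p; split=> //; apply: (coprimep_root _ pa).
  by move: psep; rewrite unlock.
exists m; split=> //; have [Em mmon ma mmin] := mP.
pose g := gcdp m m^`().
have Eg : poly_over E g.
  have /(poly_overP EP)[m1 m1E] := Em; apply/(poly_overP EP).
  by exists (gcdp m1 m1^`()); rewrite gcdp_map -deriv_map -m1E.
have gm : g %| m := dvdp_gcdl _ _.
have mE : m = m %/ g * g by rewrite divpK.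
have m0 := monic_neq0 mmon.
have g0 : g != 0 by apply: contraNneq m0 => g0; rewrite mE g0 mulr0.
have mg0 : m %/ g != 0 by apply: contraNneq m0 => h; rewrite mE h mul0r.
have ga : ~~ root g a.
  by rewrite root_gcd ma rootE.
have mga : root (m %/ g) a.
  by have := ma; rewrite {1}mE rootM (negbTE ga) orbF.
have := mmin _ (poly_over_divp EP Em Eg) mg0 mga.
rewrite {1}mE size_mul // unlock coprimep_def -/g.
have := size_poly_gt0 g; rewrite g0 => sg.
case: (size g) sg => [//|s _]; rewrite addnS /= -[leqRHS]addn0 leq_add2l leqn0.
by move=> /eqP ->.
Qed.

Lemma derivation_extend_simple_root E D a : is_subfield E -> is_derivation E D ->
  simple_root_over E a ->
  exists D', is_derivation (adjoin_seq E [:: a]) D' /\ forall x, E x -> D' x = D x.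
Proof.
move=> EP DP /(simple_root_min_poly EP)[m [mP m'a]].
(* The only possible image of [a], found by differentiating [m(a) = 0]. *)
pose u := - (map_poly D m).[a] / m^`().[a].
have [|D' [D'P D'D _]] := derivation_extend1 (a := a) (u := u) EP DP; last by exists D'.
have [Em _ ma _] := mP.
have dm : dhorner D a u m = 0 by rewrite /dhorner /u mulrC divfK // addrN.
move=> p Ep pa; have m_p := min_poly_dvd EP mP Ep pa.
rewrite -(divpK m_p) (dhornerM EP DP) //; last exact: poly_over_divp.
by rewrite (rootP ma) dm !mulr0 addr0.
Qed.

(** Every polynomial over [E] that vanishes at [a] has a derivative vanishing there, so the zero
    derivation extends with any image of [a]. This covers transcendental and inseparable [a]
    alike. *)
Lemma derivation_extend_not_simple_root E a : is_subfield E -> ~ simple_root_over E a ->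
  exists D, [/\ is_derivation (adjoin_seq E [:: a]) D,
    forall x, E x -> D x = 0 & D a = 1].
Proof.
move=> EP nsr; have D0 : is_derivation E (fun _ => 0).
  by split=> x y _ _; rewrite ?addr0 // mul0r mulr0 addr0.
have [p Ep pa|D [DP DE Da]] := derivation_extend1 (a := a) (u := 1) EP D0;
  last by exists D.
rewrite /dhorner; have -> : map_poly (fun=> 0) p = 0 :> {poly F}.
  by apply/polyP => i; rewrite coef_map_id0 // coef0.
rewrite horner0 add0r mulr1; apply/eqP/idPn => p'a; apply: nsr; by exists p.
Qed.

(* Taking the last element of [l] that is not separable over its predecessors,
   a derivation nonzero there extends to the top. *)
Lemma derivation_tower E l : is_subfield E ->
  (forall D, is_derivation E D -> exists D',
     is_derivation (adjoin_seq E l) D' /\ forall x, E x -> D' x = D x)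
  /\ (if l is a :: _ then simple_root_over E a else True)
  \/ exists D, [/\ is_derivation (adjoin_seq E l) D, forall x, E x -> D x = 0
       & exists2 x, adjoin_seq E l x & D x != 0].
Proof.
elim: l E => [|a l IH] E EP.
  left; split=> // D DP; exists D; split=> //.
  by apply: derivation_mono DP => x; apply: adjoin_seq_nil.
have E1P := adjoin_seq_subfield E [:: a].
have toE1 x : adjoin_seq E (a :: l) x -> adjoin_seq (adjoin_seq E [:: a]) l x.
  by rewrite -adjoin_seq_cat.
have [[ext _]|[D [DP D0 [x Ex Dx]]]] := IH _ E1P; last first.
  right; exists D; split; first exact: derivation_mono DP.
    by move=> y Ey; apply: D0; apply: adjoin_seq_base.
  by exists x => //; rewrite -cat1s adjoin_seq_cat.
(* Now derivations of [E(a)] extend to the top, so only the step from [E] to [E(a)] matters. *)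
have [sr|nsr] := classic (simple_root_over E a).
  left; split=> // D DP.
  have [D1 [D1P D1E]] := derivation_extend_simple_root EP DP sr.
  have [D2 [D2P D2E]] := ext _ D1P; exists D2; split.
    exact: derivation_mono D2P.
  by move=> x Ex; rewrite D2E ?D1E //; apply: adjoin_seq_base.
right; have [D1 [D1P D10 D1a]] := derivation_extend_not_simple_root EP nsr.
have [D2 [D2P D2E]] := ext _ D1P; exists D2; split.
- exact: derivation_mono D2P.
- by move=> x Ex; rewrite D2E ?D10 //; apply: adjoin_seq_base.
- exists a; first by apply: adjoin_seq_gen; rewrite inE eqxx.
  by rewrite D2E ?D1a ?oner_neq0 //; apply: adjoin_seq_gen; rewrite inE.
Qed.

(** Applying [D] to [p(a) = 0] leaves [p'(a) D(a) = 0]. *)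
Lemma derivation_simple_root E D a : is_subfield E ->
  is_derivation (fun _ => True) D -> (forall x, E x -> D x = 0) ->
  simple_root_over E a -> D a = 0.
Proof.
move=> EP DP DE [p [Ep pa p'a]].
have TP : is_subfield (fun _ : F => True) by [].
have := @derivation_horner _ _ TP DP a p I (fun _ => I).
rewrite (rootP pa) (derivation0 TP DP) /dhorner.
have -> : map_poly D p = 0.
  by apply/polyP => i; rewrite (coef_derivation TP DP) coef0 DE.
by rewrite horner0 add0r => /esym/eqP; rewrite mulf_eq0 (negbTE p'a) => /eqP.
Qed.

Lemma derivation_kernel_subfield D :
  is_derivation (fun _ => True) D -> is_subfield (fun x => D x = 0).
Proof.
move=> DP; have TP : is_subfield (fun _ : F => True) by [].
split=> [|x y Dx Dy|x y Dx Dy]; first exact: derivation1 TP DP.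
  by rewrite (derivationB TP DP) // Dx Dy subrr.
exact: (derivation_div TP DP).
Qed.

End Derivations.

(** * Existence of finite transcendence bases *)

Section TranscendenceDegree.
Variable F : fieldType.
Implicit Types (k E B : F -> Prop) (a x : F) (l s : seq F).

Lemma algebraic_rem k s a : is_subfield k ->
  algebraic_over (adjoin k (fun x => x \in s /\ x <> a)) a ->
  forall x, algebraic_over (adjoin_seq k s) x ->
    algebraic_over (adjoin_seq k (rem a s)) x.
Proof.
move=> kP alg; have remP := adjoin_seq_subfield k (rem a s).
apply: algebraic_seq_sub => // y.
  by move=> ky; apply: algebraic_base => //; apply: adjoin_seq_base.
move=> ys; have [->|ya] := eqVneq y a.
  apply: algebraic_mono alg; apply: adjoin_mono => // z [zs /eqP za].
  by rewrite rem_mem.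
by apply: algebraic_base => //; apply: adjoin_seq_gen; rewrite rem_mem.
Qed.

(** A shortest sequence in [E] over which [E] is algebraic has no repetition and no element
    algebraic over the others. *)
Lemma has_trdeg_exists k E l : is_subfield k ->
  (forall x, x \in l -> E x) ->
  (forall x, E x -> algebraic_over (adjoin_seq k l) x) ->
  exists d, has_trdeg k E d.
Proof.
move=> kP lE El; pose P n := exists s, [/\ size s = n, forall x, x \in s -> E x
  & forall x, E x -> algebraic_over (adjoin_seq k s) x].
have [n] : exists n, P n by exists (size l), l.
elim/ltn_ind: n => n IH [s [sn sE Es]].
have [[m ltmn Pm]|nex] := classic (exists2 m, (m < n)%N & P m); first exact: IH Pm.
exists n, s; split=> //.
  apply/idPn => nuniq; apply: nex; exists (size (undup s)).
    by rewrite -sn ltn_size_undup.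
  exists (undup s); split=> // [x|x /Es]; first by rewrite mem_undup; apply: sE.
  by apply: algebraic_mono; apply: adjoin_seq_mono => // y ys; rewrite mem_undup.
split=> //; apply: alg_independent_minimal => // a a_s alg; apply: nex.
exists (size (rem a s)).
  by rewrite size_rem // -sn; case: (s) a_s.
exists (rem a s); split=> // x; first by move=> /mem_rem/sE.
by move=> /Es; apply: algebraic_rem.
Qed.

(** If no list exhausted [B], duplicate-free lists in [B] of every length could be built. *)
Lemma bounded_enum B n :
  (forall l, uniq l -> (forall x, x \in l -> B x) -> (size l <= n)%N) ->
  exists l, [/\ uniq l, forall x, x \in l -> B x & forall x, B x -> x \in l].
Proof.
move=> Bn; apply: NNPP => nex.
suff [l [sl ul lB]] : exists l, [/\ size l = n.+1, uniq l & forall x, x \in l -> B x].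
  by have := Bn _ ul lB; rewrite sl ltnn.
elim: n.+1 => [|m [l [sl ul lB]]]; first by exists [::].
have [x [Bx xl]] : exists x, B x /\ x \notin l.
  apply: NNPP => nx; apply: nex; exists l; split=> // x Bx; apply/idPn => xl.
  by apply: nx; exists x.
exists (x :: l); split; rewrite /= ?sl ?xl // => y.
by rewrite inE => /predU1P[->|/lB].
Qed.

End TranscendenceDegree.

(** The primed variables stand for the derivatives of the unprimed ones. *)
Lemma quotient_rule_add (F : fieldType) (p q r s p' q' r' s' : F) :
  q != 0 -> s != 0 ->
  ((p' * s + p * s' + (r' * q + r * q')) * (q * s)
    - (p * s + r * q) * (q' * s + q * s')) / (q * s) ^+ 2 =
  (p' * q - p * q') / q ^+ 2 + (r' * s - r * s') / s ^+ 2.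
Proof. by move=> q0 s0; field; rewrite q0 s0. Qed.

Lemma quotient_rule_mul (F : fieldType) (p q r s p' q' r' s' : F) :
  q != 0 -> s != 0 ->
  ((p' * r + p * r') * (q * s) - (p * r) * (q' * s + q * s')) / (q * s) ^+ 2 =
  (p' * q - p * q') / q ^+ 2 * (r / s) + p / q * ((r' * s - r * s') / s ^+ 2).
Proof. by move=> q0 s0; field; rewrite q0 s0. Qed.

(** * Derivations of the rational function field *)

Section RationalFunctionField.
Variables (K : fieldType) (n : nat).
Local Notation F := (ratfun n K).
Implicit Types (f g : F) (D : F -> F).

Definition const_embed : {rmorphism K -> F} :=
  (fun p => tofrac p) \o @mpolyC n K.

Lemma ratfun_const_subfield : is_subfield (@ratfun_const K n).
Proof.
split=> [|_ _ [c ->] [d ->]|_ _ [c ->] [d ->]].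
- by exists 1; rewrite -[RHS]/(const_embed 1) rmorph1.
- by exists (c - d); rewrite -![tofrac _%:MP]/(const_embed _) rmorphB.
- by exists (c / d); rewrite -![tofrac _%:MP]/(const_embed _) fmorph_div.
Qed.

Definition rat_var (i : 'I_n) : F := tofrac 'X_i.

Definition rat_vars : seq F := [seq rat_var i | i <- enum 'I_n].

Lemma rat_var_mem i : rat_var i \in rat_vars.
Proof. by apply: map_f; rewrite mem_enum. Qed.

Lemma rat_vars_gen f : adjoin_seq ratfun_const rat_vars f.
Proof.
have EP := adjoin_seq_subfield (@ratfun_const K n) rat_vars.
set E := adjoin_seq _ _ in EP *.
have Ep (p : {mpoly K[n]}) : E (tofrac p).
  rewrite (mpolyE p) rmorph_sum; apply: (@subfield_sum _ E) => // m.
  rewrite -mul_mpolyC rmorphM; apply: (@subfieldM _ E) => //.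
    by apply: adjoin_seq_base; exists p@_m.
  rewrite mpolyXE_id rmorph_prod.
  apply: (big_ind E) => [|x y|i _]; [exact: (@subfield1 _ E)|exact: (@subfieldM _ E)|].
  rewrite rmorphXn; apply: (@subfieldX _ E) => //.
  by apply: adjoin_seq_gen; apply: rat_var_mem.
by rewrite (frac_repr f); apply: (@subfield_div _ E).
Qed.

(** The coefficients of [p] are constants; pulled back to [K] they give a polynomial [q] whose image
    in [F] is the value of [p] at the variables. *)
Lemma rat_var_free : eval_free ratfun_const rat_var.
Proof.
move=> p kp pX; have [c cP] := choice_fun kp.
pose q : {mpoly K[n]} := \sum_(m <- msupp p) c m *: 'X_[m].
have q0 : q = 0.
  apply/eqP; rewrite -tofrac_eq0 rmorph_sum -[X in _ == X]pX mevalE; apply/eqP.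
  apply: eq_bigr => m _; rewrite -mul_mpolyC rmorphM /= -cP mpolyXE_id rmorph_prod.
  by congr (_ * _); apply: eq_bigr => i _; rewrite -tofracXn.
apply/mpolyP => m; rewrite mcoeff0.
have [mp|mp] := boolP (m \in msupp p); last by apply: memN_msupp_eq0.
have : q@_m = 0 by rewrite q0 mcoeff0.
rewrite /q raddf_sum (bigD1_seq m) ?msupp_uniq //= mcoeffZ mcoeffX eqxx mulr1.
rewrite big1 ?addr0 => [cm|m' m'm]; last by rewrite mcoeffZ mcoeffX (negbTE m'm) mulr0.
by rewrite cP cm mpolyC0 tofrac0.
Qed.

Lemma ratderiv_tofrac j (p : {mpoly K[n]}) :
  ratderiv j (tofrac p) = tofrac (mderiv j p).
Proof.
have := @ratderivE K n j p 1 (oner_neq0 _); rewrite tofrac1 divr1 => ->.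
by rewrite -mpolyC1 mderivC mpolyC1 mulr1 mulr0 subr0 expr1n divr1.
Qed.

Lemma ratderiv_const j f : ratfun_const f -> ratderiv j f = 0.
Proof. by case=> c ->; rewrite ratderiv_tofrac mderivC tofrac0. Qed.

Lemma ratderiv_var j i : ratderiv j (rat_var i) = (i == j)%:R.
Proof.
rewrite ratderiv_tofrac mderivX mnm1E; case: eqP => [->|_];
  last by rewrite scale0r tofrac0.
have -> : (U_(j) - U_(j) = 0 :> 'X_{1..n})%MM.
  by apply/mnmP => k; rewrite mnmBE mnm0E subnn.
by rewrite scale1r mpolyX0 tofrac1.
Qed.

Lemma ratderiv_derivation j : is_derivation (fun _ => True) (@ratderiv K n j).
Proof.
split=> f g _ _; rewrite (frac_repr f) (frac_repr g).
  have := denom_ratioP (repr f); have := denom_ratioP (repr g).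
  set p := (frac (repr f)).1; set q := (frac (repr f)).2.
  set r := (frac (repr g)).1; set s := (frac (repr g)).2 => s0 q0.
  rewrite addf_div ?tofrac_eq0 // -!tofracM -tofracD !ratderivE ?mulf_neq0 //.
  rewrite !mderivD !mderivM !(tofracD, tofracN, tofracM).
  by apply: quotient_rule_add; rewrite tofrac_eq0.
have := denom_ratioP (repr f); have := denom_ratioP (repr g).
set p := (frac (repr f)).1; set q := (frac (repr f)).2.
set r := (frac (repr g)).1; set s := (frac (repr g)).2 => s0 q0.
rewrite mulf_div -!tofracM !ratderivE ?mulf_neq0 //.
rewrite !mderivM !(tofracD, tofracN, tofracM).
by apply: quotient_rule_mul; rewrite tofrac_eq0.
Qed.

(** Row vectors serve as coordinates for the derivations of [F] over [K]. *)
Definition dir_deriv (v : 'rV[F]_n) f : F := \sum_j v 0 j * ratderiv j f.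

Lemma dir_deriv_derivation v : is_derivation (fun _ => True) (dir_deriv v).
Proof.
split=> f g _ _; rewrite /dir_deriv; have dP j := ratderiv_derivation j.
  rewrite -big_split; apply: eq_bigr => j _ /=.
  by case: (dP j) => dD _; rewrite dD // mulrDr.
rewrite mulr_suml mulr_sumr -big_split; apply: eq_bigr => j _ /=.
by case: (dP j) => _ dM; rewrite dM //; ring.
Qed.

Lemma dir_deriv_const v f : ratfun_const f -> dir_deriv v f = 0.
Proof.
by move=> fc; rewrite /dir_deriv big1 // => j _; rewrite ratderiv_const // mulr0.
Qed.

Lemma dir_deriv_var v i : dir_deriv v (rat_var i) = v 0 i.
Proof.
rewrite /dir_deriv (bigD1 i) //= ratderiv_var eqxx mulr1 big1 ?addr0 // => j ji.
by rewrite ratderiv_var eq_sym (negbTE ji) mulr0.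
Qed.

(** The difference of the two derivations has a subfield as kernel, and this contains the constants
    and the variables. *)
Lemma dir_deriv_ext D : is_derivation (fun _ => True) D ->
  (forall f, ratfun_const f -> D f = 0) ->
  forall f, D f = dir_deriv (\row_j D (rat_var j)) f.
Proof.
move=> DP DC f; set v := \row_j _; have vP := dir_deriv_derivation v.
pose D' g := D g - dir_deriv v g.
have D'P : is_derivation (fun _ => True) D'.
  case: DP vP => DD DM [vD vM]; split=> g h _ _; rewrite /D'.
    by rewrite DD // vD //; ring.
  by rewrite DM // vM //; ring.
apply/eqP; rewrite -subr_eq0 -/(D' f); apply/eqP.
apply: (@adjoin_seq_sub _ _ (fun g => D' g = 0) _ _ _ _ _ (rat_vars_gen f)).
- exact: derivation_kernel_subfield.
- by move=> g gc; rewrite /D' DC // dir_deriv_const // subrr.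
- by move=> _ /mapP[i _ ->]; rewrite /D' dir_deriv_var mxE subrr.
Qed.

Lemma dir_deriv_jacobian s (phi : 'I_s -> F) v i :
  (v *m (jacobian phi)^T) 0 i = dir_deriv v (phi i).
Proof. by rewrite mxE; apply: eq_bigr => j _; rewrite !mxE. Qed.

Lemma dir_deriv_generated s (phi : 'I_s -> F) v : v *m (jacobian phi)^T = 0 ->
  forall f, generated_by phi f -> dir_deriv v f = 0.
Proof.
move=> vJ; apply: (@adjoin_sub _ _ _ (fun f => dir_deriv v f = 0)).
- exact/derivation_kernel_subfield/dir_deriv_derivation.
- exact: dir_deriv_const.
- by move=> _ [i ->]; rewrite -dir_deriv_jacobian vJ mxE.
Qed.

Lemma size_rat_vars : size rat_vars = n.
Proof. by rewrite size_map size_enum_ord. Qed.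

(** This bound and [seq_indep_size] together say that [F] has transcendence degree [n] over [K]. *)
Lemma algebraic_rat_vars_size (s : seq F) :
  (forall f, algebraic_over (adjoin_seq ratfun_const s) f) -> (n <= size s)%N.
Proof.
move=> alg; rewrite -[leqLHS]size_rat_vars.
apply: (steinitz ratfun_const_subfield) => //.
exact: eval_free_seq ratfun_const_subfield rat_var_free.
Qed.

Lemma seq_indep_size (s : seq F) : seq_indep ratfun_const s -> (size s <= n)%N.
Proof.
move=> sind; rewrite -[leqRHS]size_rat_vars.
apply: (steinitz ratfun_const_subfield sind) => f _.
by apply: algebraic_base; [exact: adjoin_seq_subfield | exact: rat_vars_gen].
Qed.

End RationalFunctionField.

(** * The Jacobian rank *)

Section MainTheorem.
Variables (K : fieldType) (n : nat) (L : ratfun n K -> Prop).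
Local Notation F := (ratfun n K).
Hypotheses (LP : is_subfield L) (constL : forall f, ratfun_const f -> L f).

Lemma intermediate_generated : exists s (phi : 'I_s -> F),
  forall f, L f <-> generated_by phi f.
Proof.
have [l lL Ll] := intermediate_fg (@ratfun_const_subfield K n) LP constL
  (fun f _ => rat_vars_gen f).
exists (size l), (fun i => nth 0 l i) => f; split=> [/Ll|].
  apply: adjoin_mono => // _ /(nthP 0)[i ltil <-].
  by exists (Ordinal ltil).
by apply: adjoin_sub => // _ [i ->]; apply/lL/mem_nth.
Qed.

Variables (s : nat) (phi : 'I_s -> F).
Hypothesis (Lphi : forall f, L f <-> generated_by phi f).
Local Notation J := (jacobian phi).
Local Notation r := (\rank J).

(* Columns on which the kernel of the Jacobian, that is the space of
   [L]-derivations of [K(x)], embeds. *)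
Lemma complementary_vars : exists2 xs : seq F, size xs = (n - r)%N &
  forall v : 'rV[F]_n, v *m J^T = 0 -> (forall f, f \in xs -> dir_deriv v f = 0) ->
  v = 0.
Proof.
(* The rows of [A] correspond to the variables; [c] selects a maximal independent set of them, of
   cardinality [\rank A = n - r]. *)
pose A := (kermx J^T)^T; pose c := maxrankfun A.
exists [seq rat_var K (c i) | i <- enum 'I_(\rank A)].
  by rewrite size_map size_enum_ord mxrank_tr mxrank_ker mxrank_tr.
move=> v /eqP vJ cv; have /submxP[w vE] : (v <= kermx J^T)%MS by apply/sub_kermxP/eqP.
have /submxP[B AE] : (A <= rowsub c A)%MS by rewrite eq_maxrowsub.
have vT : v^T = A *m w^T by rewrite vE trmx_mul.
(* Since [A = B *m rowsub c A], the vector [v] is determined by its coordinates selected by [c],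
   which are its derivatives at [xs]. *)
apply: trmx_inj; rewrite trmx0 vT AE -mulmxA mul_rowsub_mx -vT.
suff -> : rowsub c v^T = 0 by rewrite mulmx0.
apply/matrixP => i j; rewrite !mxE (ord1 j) -dir_deriv_var; apply: cv.
by apply: map_f; rewrite mem_enum.
Qed.

Lemma simple_root_over_complementary xs :
  (forall v : 'rV[F]_n, v *m J^T = 0 -> (forall f, f \in xs -> dir_deriv v f = 0) ->
    v = 0) ->
  forall f, simple_root_over (adjoin_seq L xs) f.
Proof.
move=> xs_max f; have EP := adjoin_seq_subfield L xs.
(* Putting [f] first makes the first alternative of the tower the goal itself; the variables after
   it make the tower reach all of [F]. *)
have [[] // | [D [DP D0 [g _ Dg]]]] := derivation_tower (f :: rat_vars K n) EP.
have {}DP : is_derivation (fun _ => True) D.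
  apply: derivation_mono DP => h _; have := rat_vars_gen h.
  apply: adjoin_seq_mono => [x xc|x]; last by rewrite inE orbC => ->.
  by apply: adjoin_seq_base; apply: constL.
have DE := dir_deriv_ext DP (fun h hc => D0 h (adjoin_seq_base (constL hc))).
set v := \row_j _ in DE.
have v0 : v = 0.
  apply: xs_max => [|h hxs]; last by rewrite -DE D0 //; apply: adjoin_seq_gen.
  apply/rowP => i; rewrite dir_deriv_jacobian mxE -DE D0 //.
  apply: adjoin_seq_base; apply/Lphi; apply: adjoin_gen; by exists i.
case/negP: Dg; rewrite DE v0 /dir_deriv big1 // => j _.
by rewrite mxE mul0r.
Qed.

(** Finite generation of [L] supplies a finite transcendence basis, so the choice operator in
    [trdeg] returns the size of one. *)
Lemma trdegP : exists t : seq F, [/\ uniq t, size t = trdeg ratfun_const L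
  & transcendence_basis ratfun_const L (fun f => f \in t)].
Proof.
apply: (epsilon_spec (inhabits 0%N) (has_trdeg ratfun_const L)).
have CP := @ratfun_const_subfield K n.
have [l lL Ll] := intermediate_fg CP LP constL (fun f _ => rat_vars_gen f).
apply: (has_trdeg_exists CP lL) => f /Ll; apply: algebraic_base.
exact: adjoin_seq_subfield.
Qed.

(** With [t] a transcendence basis of [L], all of [F] is algebraic over [K(t, xs)]. *)
Lemma tower_size xs : (forall f, algebraic_over (adjoin_seq L xs) f) ->
  (n <= trdeg ratfun_const L + size xs)%N.
Proof.
move=> alg; have [t [_ <- [tL _ Lt]]] := trdegP; rewrite -size_cat.
apply: algebraic_rat_vars_size => f.
have EP := adjoin_seq_subfield ratfun_const (t ++ xs).
apply: algebraic_seq_sub (alg f) => // g.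
  move=> /Lt; apply: algebraic_mono; apply: adjoin_seq_mono => // h ht.
  by rewrite mem_cat ht.
move=> gxs; apply: algebraic_base => //; apply: adjoin_seq_gen.
by rewrite mem_cat gxs orbT.
Qed.

Lemma rank_jacobian_le_trdeg : (r <= trdeg ratfun_const L)%N.
Proof.
have [xs sxs /simple_root_over_complementary xs_sr] := complementary_vars.
have := tower_size (fun f => simple_root_algebraic (xs_sr f)).
by rewrite sxs -(leq_add2r r) -addnA subnK ?rank_leq_col // [leqRHS]addnC leq_add2l.
Qed.

Lemma separably_generated_of_rank : r = trdeg ratfun_const L ->
  separably_generated L (fun _ => True).
Proof.
move=> rE; have [xs sxs /simple_root_over_complementary xs_sr] := complementary_vars.
exists (fun f => f \in xs); split=> [|f _]; last first.
  exact/(separable_overP _ (adjoin_seq_subfield _ _))/xs_sr.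
split=> // [|f _]; last exact: simple_root_algebraic (xs_sr f).
apply: alg_independent_minimal => // f fxs alg.
(* A redundant [f] could be dropped from [xs], giving [n <= r + (n - r - 1)], which is absurd. *)
have : (n <= trdeg ratfun_const L + size (rem f xs))%N.
  apply: tower_size => g.
  exact: algebraic_rem LP alg _ (simple_root_algebraic (xs_sr g)).
have xs_gt0 : (0 < size xs)%N by case: (xs) fxs.
rewrite -rE size_rem // -ltnS -addnS prednK // sxs subnKC ?rank_leq_col //.
by rewrite ltnn.
Qed.

Lemma trdeg_le_rank : separably_generated L (fun _ => True) ->
  (trdeg ratfun_const L <= r)%N.
Proof.
move=> [B [[_ Bind _] Bsep]].
have [t [ut st [tL tind _]]] := trdegP.
have CP := @ratfun_const_subfield K n.
(* Independence of [t] over [K] and of [l] over [L], which contains [K(t)], makes [t ++ l]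
   independent over [K]. *)
have B_size l : uniq l -> (forall f, f \in l -> B f) -> (size t + size l <= n)%N.
  move=> ul lB; rewrite -size_cat; apply: seq_indep_size.
  apply: seq_indep_cat => //; first exact: alg_independent_seq tind ut _.
  apply: seq_indep_mono (alg_independent_seq LP Bind ul lB) => f.
  exact: adjoin_seq_sub.
have [|l [ul lB Bl]] := @bounded_enum _ B n.
  by move=> l ul lB; apply: leq_trans (B_size l ul lB); apply: leq_addl.
have lt := B_size _ ul lB; rewrite -st.
pose M : 'M[F]_(n, size l) := \matrix_(j, i) ratderiv j (nth 0 l i).
(* A vector killed by this matrix is a derivation vanishing on [L] and on [B]. Full row rank gives
   [n <= r + size l], to be compared with [size t + size l <= n]. *)
suff full : row_free (row_mx J^T M).
  rewrite -(leq_add2r (size l)) (leq_trans lt) // -[leqLHS](eqP full).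
  rewrite -mxrank_tr tr_row_mx trmxK.
  have := mxrank_adds_leqif J M^T; rewrite addsmxE => -[le _].
  by apply: leq_trans le _; rewrite leq_add2l rank_leq_row.
apply/inj_row_free => v; rewrite mul_mx_row => /eqP.
rewrite row_mx_eq0 => /andP[/eqP vJ /eqP vM].
have vP := dir_deriv_derivation v.
have vL f : L f -> dir_deriv v f = 0 by move=> /Lphi; apply: dir_deriv_generated.
have vl f : f \in l -> dir_deriv v f = 0.
  move=> /(nthP 0)[i ltil <-]; move/rowP: vM => /(_ (Ordinal ltil)).
  rewrite !mxE => vMi; rewrite -[RHS]vMi.
  by apply: eq_bigr => j _; rewrite mxE.
have LBP : is_subfield (adjoin L B) := adjoin_subfield L B.
apply/rowP => j; rewrite mxE -dir_deriv_var.
(* Each variable is separable over [L(B)], so the derivation vanishes on it, and its value there is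
   a coordinate of [v]. *)
have /(separable_overP _ LBP) := Bsep (rat_var K j) I.
apply: derivation_simple_root => // f.
apply: (@adjoin_sub _ _ _ (fun f => dir_deriv v f = 0)) => //.
  exact: derivation_kernel_subfield.
by move=> g /Bl/vl.
Qed.

End MainTheorem.

Theorem theorem1p3 (K : fieldType) (n : nat) (L : ratfun n K -> Prop) :
  is_subfield L ->
  (forall f, ratfun_const f -> L f) ->
  (exists (s : nat) (phi : 'I_s -> ratfun n K),
      forall f, L f <-> generated_by phi f)
  /\
  (forall (s : nat) (phi : 'I_s -> ratfun n K),
      (forall f, L f <-> generated_by phi f) ->
      (\rank (jacobian phi) <= trdeg ratfun_const L)%N
      /\ (\rank (jacobian phi) = trdeg ratfun_const L
          <-> separably_generated L (fun _ => True))).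
Proof.
move=> LP constL; split; first exact: intermediate_generated.
move=> s phi Lphi; have le_rank := rank_jacobian_le_trdeg LP constL Lphi.
split=> //; split; first exact: separably_generated_of_rank.
move=> /(trdeg_le_rank LP constL Lphi) le_trdeg.
by apply/eqP; rewrite eqn_leq le_rank.
Qed.
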